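(* Let $\lambda$ be a Young diagram, let $\mathcal A_\lambda=\{a(i,j):(i,j)\in\lambda\}$ be the multiset of area numbers and $\mathcal A^\ast_\lambda=\{a^\ast(i,j):(i,j)\in\lambda\}$ the multiset of anti-area numbers. Then $\mathcal A_\lambda$ majorizes $\mathcal A^\ast_\lambda$.
   Context: Let $\lambda=(\lambda_1\ge\dots\ge\lambda_\ell>0)$ be an integer partition; its Young diagram is the set of squares $(i,j)$ with $1\le i\le\ell$, $1\le j\le\lambda_i$. For $(i,j)\in\lambda$: $a(i,j)=|\{(p,q)\in\lambda: i\le p,\ j\le q\}|$ and $a^\ast(i,j)=i\cdot j$. Majorization: for two multisets $\mathcal A,\mathcal B$ of $n$ real numbers, let $a_1\ge\dots\ge a_n$ and $b_1\ge\dots\ge b_n$ be their elements in non-increasing order. $\mathcal A$ majorizes $\mathcal B$ if $a_1+\dots+a_k\ge b_1+\dots+b_k$ for all $1\le k<n$ and $a_1+\dots+a_n=b_1+\dots+b_n$. *)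

(* Defs.v *)
From mathcomp Require Import all_boot all_order all_algebra.

Set Implicit Arguments.
Unset Strict Implicit.
Unset Printing Implicit Defensive.

Import Order.TTheory GRing.Theory Num.Theory.

Definition is_partition (la : seq nat) : bool := sorted geq la && (0 \notin la).

(* Rows and columns are numbered from 1, so row i has length nth 0 la i.-1. *)
Definition squares (la : seq nat) : seq (nat * nat) :=
  [seq (i, j) | i <- iota 1 (size la), j <- iota 1 (nth 0 la i.-1)].

Lemma mem_squares (la : seq nat) (i j : nat) :
  ((i, j) \in squares la) =
  (1 <= i <= size la) && (1 <= j <= nth 0 la i.-1).
Proof.
apply/allpairsPdep/idP => [[p [q [+ + [-> ->]]]]|/andP[hi hj]].
  by rewrite !mem_iota !add1n !ltnS => -> ->.
by exists i, j; rewrite !mem_iota !add1n !ltnS.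
Qed.

Lemma uniq_squares (la : seq nat) : uniq (squares la).
Proof.
apply: allpairs_uniq_dep; first exact: iota_uniq.
- by move=> i _; exact: iota_uniq.
- by move=> [? ?] [? ?] _ _ /= [-> ->].
Qed.

(* squares la is duplicate-free, so count is the cardinality. *)
Definition area (la : seq nat) (c : nat * nat) : nat :=
  count (fun d => (c.1 <= d.1) && (c.2 <= d.2)) (squares la).

Definition antiarea (c : nat * nat) : nat := c.1 * c.2.

Local Open Scope ring_scope.

(* Multisets are represented by sequences, whose order is irrelevant below
   because of the sorting. *)
Definition top_sum (R : realDomainType) (k : nat) (A : seq R) : R :=
  \sum_(x <- take k (sort >=%O A)) x.

Definition majorizes (R : realDomainType) (A B : seq R) : Prop :=
  [/\ size A = size B,
      forall k : nat, (1 <= k < size A)%N -> top_sum k B <= top_sum k A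
    & top_sum (size A) A = top_sum (size B) B].

Lemma majorizes_perm (R : realDomainType) (A A' B B' : seq R) :
  perm_eq A A' -> perm_eq B B' -> majorizes A B -> majorizes A' B'.
Proof.
have sortE (C C' : seq R) : perm_eq C C' -> sort >=%O C = sort >=%O C'.
  move=> CC'; apply/perm_sortP => //.
  - by move=> x y; exact: le_total.
  - by move=> y x z /= yx zy; exact: le_trans zy yx.
  - by move=> x y; rewrite andbC; exact: le_anti.
move=> AA' BB'; rewrite /majorizes /top_sum.
by rewrite (sortE _ _ AA') (sortE _ _ BB') (perm_size AA') (perm_size BB').
Qed.

Definition areas (R : realDomainType) (la : seq nat) : seq R :=
  [seq (area la c)%:R | c <- squares la].

Definition antiareas (R : realDomainType) (la : seq nat) : seq R :=
  [seq (antiarea c)%:R | c <- squares la].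

(* Main.v *)
Require Import Defs.
From mathcomp Require Import all_boot all_order all_algebra.
From mathcomp Require Import zify lra.

(** By the Hardy-Littlewood-Polya criterion it suffices to compare the sums of
    [f] over both multisets for convex [f].  Argue by induction on the rows.
    Adding a last row of length [m], as row [n+1], raises the area of a square
    of column [j <= m] by [x = m+1-j], and the area of the square of row [i] was
    at least [(n+1-i)x] before.  Hence, by convexity, the sum of [f] over the
    areas of column [j] grows by at least the telescoping sum of
    [f((k+1)x) - f(kx)] for [0 < k <= n], plus [f(x)] for the new square, that
    is by [f((n+1)x)].  Over all [j] these are the new anti-areas. *)

Set Implicit Arguments.
Unset Strict Implicit.
Unset Printing Implicit Defensive.

Import Order.TTheory GRing.Theory Num.Theory.

Local Open Scope ring_scope.

Section TopSums.

Variable R : realDomainType.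
Implicit Types (A B : seq R) (t : R).

Lemma sum_sort_ge A (F : R -> R) : \sum_(x <- sort >=%O A) F x = \sum_(x <- A) F x.
Proof. by apply: perm_big; rewrite perm_sort. Qed.

Lemma top_sum_size A : top_sum (size A) A = \sum_(x <- A) x.
Proof. by rewrite /top_sum -(size_sort >=%O) take_size sum_sort_ge. Qed.

(** Each of the [k] largest entries satisfies [x <= t + max 0 (x - t)], and the excesses over [t] of
    the other entries are nonnegative. *)
Lemma top_sum_le_excess A (k : nat) t : (k <= size A)%N ->
  top_sum k A <= t *+ k + \sum_(x <- A) Num.max 0 (x - t).
Proof.
move=> kA; rewrite -(sum_sort_ge A) /top_sum.
have szk : size (take k (sort >=%O A)) = k by rewrite size_takel // size_sort.
rewrite -[in X in _ <= _ + X](cat_take_drop k (sort >=%O A)) big_cat /= addrA.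
rewrite -[leLHS]addr0 lerD //; last first.
  by apply: sumr_ge0 => x _; rewrite le_max lexx.
have -> : t *+ k = \sum_(x <- take k (sort >=%O A)) t.
  by rewrite big_const_seq count_predT szk iter_addr_0.
rewrite -big_split /=; apply: ler_sum => x _.
by rewrite -lerBlDl le_max lexx orbT.
Qed.

(** The bound of [top_sum_le_excess] is attained when [t] is the [k]-th largest entry: the first [k]
    sorted entries are at least [t], and the later ones have no excess. *)
Lemma top_sum_excess A (k : nat) : (0 < k <= size A)%N ->
  let t := (sort >=%O A)`_k.-1 in
  top_sum k A = t *+ k + \sum_(x <- A) Num.max 0 (x - t).
Proof.
case: k => // k kA t; rewrite -(sum_sort_ge A) /top_sum.
have szs : size (sort >=%O A) = size A by rewrite size_sort.
have ge_tr : transitive (>=%O : rel R) by move=> y x z yx zy; exact: le_trans zy yx.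
have srt : sorted >=%O (sort >=%O A) by apply: sort_sorted => x y; exact: le_total.
have mono i j : (i <= j < size A)%N -> (sort >=%O A)`_j <= (sort >=%O A)`_i.
  move=> /andP[ij jA].
  apply: (sorted_leq_nth ge_tr (@lexx _ R) 0 srt) => //; rewrite inE szs //.
  exact: leq_ltn_trans jA.
rewrite -[in X in _ = _ + X](cat_take_drop k.+1 (sort >=%O A)) big_cat /= addrA.
have szk : size (take k.+1 (sort >=%O A)) = k.+1 by rewrite size_takel ?szs.
rewrite [X in _ + X]big1_seq ?addr0 => [|x /andP[_ /(nthP 0) [i + <-]]]; last first.
  rewrite size_drop szs nth_drop => iA.
  by apply/max_idPl; rewrite subr_le0; apply: mono; lia.
have -> : t *+ k.+1 = \sum_(x <- take k.+1 (sort >=%O A)) t.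
  by rewrite big_const_seq count_predT szk iter_addr_0.
rewrite -big_split /=; apply: eq_big_seq => x /(nthP 0) [i + <-].
rewrite szk => ik; rewrite nth_take //.
have -> : Num.max 0 ((sort >=%O A)`_i - t) = (sort >=%O A)`_i - t.
  by apply/max_idPr; rewrite subr_ge0; apply: mono; lia.
by rewrite addrC subrK.
Qed.

(** Among convex functions, the hinges [max 0 (x - t)] suffice. With [t] the [k]-th largest entry of
    [A], the excess bound is an equality for [A] and an inequality for [B]. *)
Lemma majorizes_of_excess A B : size A = size B ->
  \sum_(x <- A) x = \sum_(x <- B) x ->
  (forall t, \sum_(x <- B) Num.max 0 (x - t) <= \sum_(x <- A) Num.max 0 (x - t)) ->
  majorizes A B.
Proof.
move=> szAB sumAB exc; split => //; last by rewrite !top_sum_size.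
move=> k /andP[k0 kA]; rewrite (top_sum_excess (A := A)) ?k0 ?(ltnW kA) //.
set t := (sort _ A)`_k.-1.
apply: le_trans (top_sum_le_excess t _) _; first by rewrite -szAB ltnW.
by rewrite lerD2l.
Qed.

End TopSums.

Lemma squares_rcons (mu : seq nat) (m : nat) :
  squares (rcons mu m) = squares mu ++ [seq ((size mu).+1, j) | j <- iota 1 m].
Proof.
rewrite /squares size_rcons -[in LHS](addn1 (size mu)) iotaD map_cat flatten_cat.
rewrite /= cats0 add1n nth_rcons ltnn eqxx; congr (flatten _ ++ _).
apply/eq_in_map => i; rewrite mem_iota => hi; rewrite nth_rcons.
by have -> : (i.-1 < size mu)%N by lia.
Qed.

Lemma count_leq_iota (j m : nat) : (0 < j)%N -> count (leq j) (iota 1 m) = (m.+1 - j)%N.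
Proof.
move=> j0; elim: m => [|m IHm]; first by rewrite /=; lia.
by rewrite -[in LHS](addn1 m) iotaD count_cat IHm /= addn0 add1n; lia.
Qed.

Lemma area_rcons (mu : seq nat) (m i j : nat) : (0 < j)%N ->
  area (rcons mu m) (i, j) = (area mu (i, j) + (i <= (size mu).+1) * (m.+1 - j))%N.
Proof.
move=> j0; rewrite /area squares_rcons count_cat count_map -count_leq_iota //.
congr (_ + _)%N; case: leqP => hi; rewrite ?mul1n ?mul0n; apply/eqP.
  by apply/eqP/eq_count => p /=; rewrite hi.
by rewrite -leqn0 leqNgt -has_count; apply/hasPn => p _ /=; rewrite leqNgt hi.
Qed.

(** All rows reach column [m], so the rectangle of rows [i] to [size mu] and columns [j] to [m] lies
    in the diagram. Truncated subtraction makes the bound zero when this rectangle is empty. *)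
Lemma area_ge (mu : seq nat) (m i j : nat) :
  (0 < i)%N -> (0 < j)%N -> all (leq m) mu ->
  (((size mu).+1 - i) * (m.+1 - j) <= area mu (i, j))%N.
Proof.
move=> i0 j0; elim/last_ind: mu => [|mu q IHmu].
  by have -> : ((size (Nil nat)).+1 - i = 0)%N by rewrite /=; lia.
rewrite all_rcons => /andP[mq /IHmu {}IHmu].
by rewrite area_rcons // size_rcons; case: leqP => hi; nia.
Qed.

Section ConvexSums.

Variables (R : realDomainType) (f : nat -> R).
Hypothesis f_convex : forall a b x : nat, (b <= a)%N ->
  f (b + x)%N - f b <= f (a + x)%N - f a.

Lemma sum_squares (mu : seq nat) (F : nat -> nat -> R) :
  \sum_(c <- squares mu) F c.1 c.2 =
  \sum_(1 <= i < (size mu).+1) \sum_(1 <= j < (nth 0%N mu i.-1).+1) F i j.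
Proof.
rewrite big_allpairs_dep /index_iota subn1 /=.
by apply: eq_bigr => i _; rewrite /index_iota subn1.
Qed.

Lemma telescope_multiples (n x : nat) :
  \sum_(1 <= i < n.+1) (f ((n.+1 - i) * x + x)%N - f ((n.+1 - i) * x)%N) =
  f (n.+1 * x)%N - f x.
Proof.
rewrite big_nat_rev /=.
transitivity (\sum_(1 <= i < n.+1) (f (i.+1 * x)%N - f (i * x)%N)).
  apply: eq_big_nat => i hi.
  have -> : (n.+1 - (1 + n.+1 - i.+1) = i)%N by lia.
  by rewrite mulSn addnC.
by rewrite (telescope_sumr (fun k => f (k * x)%N)) ?mul1n.
Qed.

Lemma area_growth (mu : seq nat) (m : nat) : all (leq m) mu ->
  \sum_(1 <= j < m.+1) (f ((size mu).+1 * j)%N - f j) <=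
  \sum_(c <- squares mu) (f (area mu c + (m.+1 - c.2))%N - f (area mu c)).
Proof.
(* Reversal turns the index into a column [j], with [x = m+1-j] as the multiplier. *)
move=> mmu; rewrite big_nat_rev /=.
under eq_bigr => j _ do rewrite -telescope_multiples.
rewrite exchange_big /=.
have -> : \sum_(c <- squares mu) (f (area mu c + (m.+1 - c.2))%N - f (area mu c)) =
  \sum_(c <- squares mu)
     (f (area mu (c.1, c.2) + (m.+1 - c.2))%N - f (area mu (c.1, c.2))).
  by apply: eq_bigr => -[i j].
rewrite (sum_squares mu (fun i j =>
  f (area mu (i, j) + (m.+1 - j))%N - f (area mu (i, j)))).
rewrite big_nat_cond [leRHS]big_nat_cond; apply: ler_sum => i /andP[hi _].
have i_mu : (i.-1 < size mu)%N by lia.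
have mi : (m <= nth 0%N mu i.-1)%N by exact/(allP mmu)/mem_nth.
(* Columns beyond [m] contribute nothing, since there [m.+1 - j] truncates to 0. *)
rewrite [leRHS](big_cat_nat (n := m.+1)) //= [X in _ + X]big_nat_cond.
rewrite [X in _ + X]big1 ?addr0 => [|j /andP[hj _]]; last first.
  have -> : (m.+1 - j = 0)%N by lia.
  by rewrite addn0 subrr.
rewrite big_nat_cond [leRHS]big_nat_cond; apply: ler_sum => j /andP[hj _].
have -> : (1 + m.+1 - j.+1 = m.+1 - j)%N by lia.
by apply/f_convex/area_ge => //; lia.
Qed.

Lemma sum_antiarea_le_sum_area (la : seq nat) : sorted geq la ->
  \sum_(c <- squares la) f (antiarea c) <= \sum_(c <- squares la) f (area la c).
Proof.
elim/last_ind: la => [|mu m IHmu]; first by rewrite !big_nil.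
(* Reversing puts the last row [m] at the head, so sortedness bounds it by every row of [mu]. *)
rewrite -[sorted _ _]rev_sorted rev_rcons /= path_sortedE; last first.
  by move=> y x z /= yx zy; exact: leq_trans yx zy.
rewrite all_rev rev_sorted => /andP[mmu /IHmu {}IHmu].
rewrite squares_rcons !big_cat !big_map /=.
have -> : \sum_(c <- squares mu) f (area (rcons mu m) c) =
          \sum_(c <- squares mu) f (area mu c + (m.+1 - c.2))%N.
  apply: eq_big_seq => -[i j]; rewrite mem_squares => hij.
  rewrite area_rcons; last by lia.
  have -> : (i <= (size mu).+1)%N by lia.
  by rewrite mul1n.
have -> : \sum_(j <- iota 1 m) f (area (rcons mu m) ((size mu).+1, j)) =
          \sum_(1 <= j < m.+1) f j.
  (* No square of [mu] lies in the new row, so its areas are [m], ..., 1 from left to right. *)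
  rewrite [RHS]big_nat_rev /= /index_iota subn1 /=.
  apply: eq_big_seq => j; rewrite mem_iota => hj.
  rewrite area_rcons ?leqnn ?mul1n; last by lia.
  rewrite (_ : area mu _ = 0%N) ?add0n; first by congr f; lia.
  apply/eqP; rewrite -leqn0 leqNgt -has_count; apply/hasPn => -[p q].
  by rewrite mem_squares /=; lia.
have := area_growth mmu; rewrite !big_split /= !sumrN.
have -> : \sum_(j <- iota 1 m) f (antiarea ((size mu).+1, j)) =
          \sum_(1 <= j < m.+1) f ((size mu).+1 * j)%N.
  by rewrite /index_iota subn1.
by move: IHmu; lra.
Qed.

End ConvexSums.

Theorem theorem3p4 (R : realDomainType) (la : seq nat) :
  is_partition la -> majorizes (areas R la) (antiareas R la).
Proof.
move=> /andP[srt _]; apply: majorizes_of_excess; first by rewrite !size_map.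
  (* The totals agree because both the identity and its negative are convex. *)
  apply/eqP; rewrite eq_le !big_map -lerN2 -!sumrN; apply/andP; split.
    apply: (@sum_antiarea_le_sum_area R (fun v => - v%:R)) srt.
    by move=> a b x _; rewrite !natrD; lra.
  apply: (@sum_antiarea_le_sum_area R (fun v => v%:R)) srt.
  by move=> a b x _; rewrite !natrD; lra.
move=> t; rewrite !big_map.
apply: (@sum_antiarea_le_sum_area R (fun v => Num.max 0 (v%:R - t))) srt.
move=> a b x; rewrite -(ler_nat R) !natrD.
have : 0 <= x%:R :> R by [].
(* Convexity of the hinge is linear arithmetic once the sign at each of the four points is fixed. *)
case: (leP 0 (b%:R + x%:R - t)); case: (leP 0 (b%:R - t));
  case: (leP 0 (a%:R + x%:R - t)); case: (leP 0 (a%:R - t)); lra.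
Qed.
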